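(* For every $n\in\mathbb{N}$ the graph $G(3,n)$ has a Hamiltonian path, and for every even $n>2$ the graph $G(3,n)$ is Hamiltonian (has a Hamiltonian cycle).
   Context: For a prime $p$ and $n\in\mathbb{N}$, $G(p,n)$ is the simple graph with vertex set $\{2,4,\ldots,2n\}$ in which two distinct vertices $a,b$ are adjacent if and only if both $\frac{a+b}{2}$ and $\frac{|a-b|}{2}$ are odd positive integers neither of which equals $pk$ for an integer $k\ge 2$. *)

(* Defs.v *)
From HB Require Import structures.
From mathcomp Require Import all_boot all_order all_algebra.
From mathcomp Require Import zify.

Set Implicit Arguments.
Unset Strict Implicit.
Unset Printing Implicit Defensive.

Import IntDist.

Record sgraph := SGraph {
  vertex :> finType;
  adj : rel vertex;
  adj_sym : symmetric adj;
  adj_irrefl : irreflexive adj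
}.

Definition has_hamiltonian_path (G : sgraph) : Prop :=
  exists s : seq G, [/\ sorted (@adj G) s, uniq s & forall v : G, v \in s].

(* The closed walk [cycle] alone would accept an edge traversed back and forth;
   a graph cycle has at least three vertices. *)
Definition hamiltonian (G : sgraph) : Prop :=
  exists s : seq G,
    [/\ cycle (@adj G) s, uniq s, 2 < size s & forall v : G, v \in s].

(* The bound on k only serves decidability, see [allowedP]. *)
Definition allowed (p m : nat) : bool :=
  [&& odd m, 0 < m & ~~ [exists k : 'I_m.+1, (2 <= k) && (m == p * k)]].

Lemma allowedP (p m : nat) :
  reflect [/\ odd m, 0 < m & ~ exists2 k : nat, 2 <= k & m = p * k]
          (allowed p m).
Proof.
apply: (iffP and3P) => -[om m0 H]; split => //.
- case=> k k2 mE; case/negP: H; apply/existsP.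
  have km : k < m.+1 by case: p mE => [|p] mE; nia.
  by exists (Ordinal km); rewrite /= k2 -mE eqxx.
- apply/negP => /existsP[k /andP[k2 /eqP mE]].
  by apply: H; exists (k : nat).
Qed.

Definition Gvertices (n : nat) : seq nat := [seq 2 * i | i <- iota 1 n].

Definition Gadj (p n : nat) : rel (seq_sub (Gvertices n)) :=
  fun u v => let a := val u in let b := val v in
    [&& a != b, allowed p ((a + b) %/ 2) & allowed p (`|a - b| %/ 2)].

Lemma Gadj_sym p n : symmetric (@Gadj p n).
Proof. by move=> u v; rewrite /Gadj eq_sym addnC distnC. Qed.

Lemma Gadj_irrefl p n : irreflexive (@Gadj p n).
Proof. by move=> u; rewrite /Gadj eqxx. Qed.

Definition G (p n : nat) : sgraph := SGraph (@Gadj_sym p n) (@Gadj_irrefl p n).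

(* Main.v *)
Require Import Defs.
From mathcomp Require Import all_boot.
From mathcomp Require Import all_order all_algebra zify.

Import IntDist.

(** Halve the labels, so that the vertices are 1, ..., n.  For p = 3 every
    multiple of 3 is adjacent to every non-multiple of opposite parity, the
    non-multiples i and i + 3 are adjacent, and so are 1 and 2.  Apart from the
    edge {1, 2}, this adjacency is invariant under translation by 6.  Hence a
    path on 1, ..., r can be prolonged by consecutive translates, by multiples
    of 6, of one fixed path on r + 1, ..., r + 6, and r = 1, ..., 6 give the
    Hamiltonian paths.  Between a multiple of 3 and a non-multiple, adjacency
    depends only on residues mod 6, so for r = 4, 6, 8 the base path can be
    chosen in such a way that all its prolongations close up to cycles. *)

Definition Gnat (p : nat) : rel nat := fun a b =>
  [&& a != b, allowed p ((a + b) %/ 2) & allowed p (`|a - b| %/ 2)].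

(** As subtraction truncates, [(x - y) + (y - x)] is the distance. It has the parity of [x + y], so
    one oddness test serves both. *)
Definition half_adj : rel nat := fun x y =>
  [&& odd (x + y), (x + y == 3) || ~~ (3 %| x + y)
    & ((x - y) + (y - x) == 3) || ~~ (3 %| (x - y) + (y - x))].

Definition shift_adj : rel nat := fun x y =>
  half_adj x y && ~~ (3 %| x + y).

(** The two non-divisibilities say that exactly one of [x], [y] is a multiple of 3; hence one
    endpoint may move by [6 * k] while the other stays. *)
Definition resid_adj : rel nat := fun x y =>
  [&& odd (x + y), ~~ (3 %| x + y) & ~~ (3 %| (x - y) + (y - x))].

Lemma allowed3 (m : nat) :
  odd m -> (m == 3) || ~~ (3 %| m) -> allowed 3 m.
Proof.
move=> om m3; apply/allowedP; split=> //; first by case: m om {m3}.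
case=> k k2 mE; move: m3; rewrite mE dvdn_mulr // orbF => /eqP; lia.
Qed.

Lemma half_adjP (x y : nat) : half_adj x y -> Gnat 3 (2 * x) (2 * y).
Proof.
case/and3P=> oxy sxy dxy; apply/and3P; split; first by apply/eqP; lia.
- have -> : (2 * x + 2 * y) %/ 2 = x + y by lia.
  exact: allowed3.
- have -> : `|2 * x - 2 * y| %/ 2 = (x - y) + (y - x) by lia.
  apply: allowed3 => //; lia.
Qed.

Lemma shift_half_adj (k x y : nat) :
  shift_adj x y -> half_adj (6 * k + x) (6 * k + y).
Proof. rewrite /shift_adj /half_adj; lia. Qed.

Lemma resid_half_adj (k x y : nat) :
  resid_adj x y -> half_adj (6 * k + x) y.
Proof. rewrite /resid_adj /half_adj; lia. Qed.

Fixpoint prolong (b c : seq nat) (k : nat) : seq nat :=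
  if k is k'.+1 then prolong b c k' ++ [seq 6 * k' + x | x <- c] else b.

Lemma prolong_perm (r k : nat) (b c : seq nat) :
  perm_eq b (iota 1 r) -> perm_eq c (iota r.+1 6) ->
  perm_eq (prolong b c k) (iota 1 (6 * k + r)).
Proof.
move=> pb pc; elim: k => [//|k IHk].
have -> : 6 * k.+1 + r = (6 * k + r) + 6 by lia.
rewrite iotaD perm_cat //.
have -> : 1 + (6 * k + r) = 6 * k + r.+1 by lia.
by rewrite iotaDl; apply: perm_map.
Qed.

(** Each block ends 6 further than the previous one, so every junction is a translate of the
    first. *)
Lemma prolong_last (x0 y0 k : nat) (b c : seq nat) :
  last y0 c = 6 + last x0 b -> c != [::] ->
  last x0 (prolong b c k) = 6 * k + last x0 b.
Proof.
move=> lc; case: c lc => //= y c lc _.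
by case: k => [|k] //=; rewrite last_cat /= last_map lc; lia.
Qed.

Lemma prolong_path (x0 y k : nat) (b c : seq nat) :
  last y c = 6 + last x0 b -> path half_adj x0 b ->
  shift_adj (last x0 b) y -> path shift_adj y c ->
  path half_adj x0 (prolong b (y :: c) k).
Proof.
move=> lc pb lby pc; elim: k => [|k IHk] //=.
rewrite cat_path IHk /= (@prolong_last _ y) // shift_half_adj //=.
rewrite path_map; apply: sub_path pc => u v; exact: shift_half_adj.
Qed.

Lemma prolong_cons (x0 : nat) (b c : seq nat) (k : nat) :
  prolong (x0 :: b) c k = x0 :: prolong b c k.
Proof. by elim: k => //= k ->. Qed.

Definition nat_ham_path (n : nat) : Prop :=
  exists2 s : seq nat, sorted half_adj s & perm_eq s (iota 1 n).

Definition nat_ham_cycle (n : nat) : Prop :=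
  exists2 s : seq nat, cycle half_adj s & perm_eq s (iota 1 n).

(** A boolean certificate, so that concrete instances hold by computation. *)
Definition path_data (r x0 y : nat) (b c : seq nat) : bool :=
  [&& perm_eq (x0 :: b) (iota 1 r), perm_eq (y :: c) (iota r.+1 6),
      last y c == 6 + last x0 b, path half_adj x0 b,
      shift_adj (last x0 b) y & path shift_adj y c].

Lemma path_data_ham_path (r x0 y k : nat) (b c : seq nat) :
  path_data r x0 y b c -> nat_ham_path (6 * k + r).
Proof.
case/and5P=> pb pc /eqP lc hb /andP[lby hc].
exists (prolong (x0 :: b) (y :: c) k); last exact: prolong_perm.
by rewrite prolong_cons /=; apply: prolong_path.
Qed.

Lemma path_data_ham_cycle (r x0 y k : nat) (b c : seq nat) :
  path_data r x0 y b c -> resid_adj (last x0 b) x0 ->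
  nat_ham_cycle (6 * k + r).
Proof.
case/and5P=> pb pc /eqP lc hb /andP[lby hc] cl.
exists (prolong (x0 :: b) (y :: c) k); last exact: prolong_perm.
rewrite prolong_cons /= rcons_path prolong_path //= (@prolong_last _ y) //.
exact: resid_half_adj.
Qed.

Lemma nat_ham_path_all (n : nat) : nat_ham_path n.
Proof.
case: n => [|n]; first by exists [::].
(* Remainders are taken in 1, ..., 6 to keep the base path nonempty. *)
have -> : n.+1 = 6 * (n %/ 6) + (n %% 6).+1 by lia.
have: n %% 6 < 6 by rewrite ltn_mod.
case: (n %% 6) => [|[|[|[|[|[|r]]]]]] // _.
- exact: (@path_data_ham_path 1 1 6 _ [::] [:: 5; 2; 3; 4; 7]).
- exact: (@path_data_ham_path 2 1 3 _ [:: 2] [:: 4; 7; 6; 5; 8]).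
- exact: (@path_data_ham_path 3 1 4 _ [:: 2; 3] [:: 7; 6; 5; 8; 9]).
- exact: (@path_data_ham_path 4 4 8 _ [:: 1; 2; 3] [:: 5; 6; 7; 10; 9]).
- exact: (@path_data_ham_path 5 3 6 _ [:: 4; 1; 2; 5] [:: 7; 10; 9; 8; 11]).
- exact: (@path_data_ham_path 6 1 7 _ [:: 4; 3; 2; 5; 6]
           [:: 10; 9; 8; 11; 12]).
Qed.

Lemma nat_ham_cycle_even (n : nat) : ~~ odd n -> 2 < n -> nat_ham_cycle n.
Proof.
move=> en n2.
(* Two vertices carry no graph cycle, so the class of 2 modulo 6 starts from 8. *)
have [nE|[nE|nE]] : n = 6 * ((n - 4) %/ 6) + 4 \/
    n = 6 * ((n - 4) %/ 6) + 6 \/ n = 6 * ((n - 4) %/ 6) + 8 by lia.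
- rewrite nE.
  exact: (@path_data_ham_cycle 4 4 8 _ [:: 1; 2; 3] [:: 5; 6; 7; 10; 9]).
- rewrite nE.
  exact: (@path_data_ham_cycle 6 1 7 _ [:: 4; 3; 2; 5; 6]
           [:: 10; 9; 8; 11; 12]).
- rewrite nE.
  exact: (@path_data_ham_cycle 8 3 9 _ [:: 4; 7; 6; 1; 2; 5; 8]
           [:: 10; 13; 12; 11; 14]).
Qed.

Lemma perm_lift (n : nat) (s : seq nat) : perm_eq s (iota 1 n) ->
  exists t : seq (seq_sub (Gvertices n)),
    [/\ map val t = [seq 2 * i | i <- s], uniq t, size t = n
      & forall v, v \in t].
Proof.
move=> ps; have pG : perm_eq [seq 2 * i | i <- s] (Gvertices n).
  exact: perm_map.
exists (pmap insub [seq 2 * i | i <- s]).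
(* Every entry is a vertex label, so [insub] succeeds throughout and [pmap] drops nothing. *)
have tE : map val (pmap insub [seq 2 * i | i <- s] :
    seq (seq_sub (Gvertices n))) = [seq 2 * i | i <- s].
  rewrite (pmap_filter (insubK _)); apply/all_filterP/allP => a.
  by rewrite (perm_mem pG) => aG; rewrite insubT.
split=> //.
- rewrite -(map_inj_uniq val_inj) tE map_inj_uniq ?(perm_uniq ps) ?iota_uniq //.
  by move=> i j; lia.
- by rewrite -(size_map val) tE size_map (perm_size ps) size_iota.
- by move=> v; rewrite -(mem_map val_inj) tE (perm_mem pG); apply: valP.
Qed.

Theorem theorem4p6 :
  (forall n : nat, has_hamiltonian_path (G 3 n)) /\
  (forall n : nat, ~~ odd n -> 2 < n -> hamiltonian (G 3 n)).
Proof.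
split=> n.
- have [s ss /perm_lift[t [tE ut _ mt]]] := nat_ham_path_all n.
  exists t; split=> //.
  (* Adjacency in [G 3 n] is convertible to the pullback of [Gnat 3] along [val]. *)
  change (sorted (relpre val (Gnat 3)) t); rewrite -sorted_map tE sorted_map.
  apply: sub_sorted ss; exact: half_adjP.
- move=> en n2.
  have [s ss /perm_lift[t [tE ut zt mt]]] := nat_ham_cycle_even n en n2.
  exists t; split=> //; last by rewrite zt.
  change (cycle (relpre val (Gnat 3)) t); rewrite -cycle_map tE cycle_map.
  apply: sub_cycle ss; exact: half_adjP.
Qed.
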